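(* Let $T\in\mathbb{R}^{M\times M}$ be symmetric positive definite, let $D\in\mathbb{R}^{M\times M}$ be diagonal with nonpositive diagonal entries, and let $\omega>0$. Let $\mathcal{B},\mathcal{H},\mathcal{L}_\omega$ be as defined in the context. Then $\omega I+\mathcal{B}$ and $\omega I+\mathcal{H}$ are invertible, and the spectral radius of $\mathcal{L}_\omega$ satisfies $$\rho(\mathcal{L}_\omega)\le \sigma(\omega)<1,\qquad \sigma(\omega)=\max_{\lambda_i\in\lambda(D)}\left|\frac{\omega+\lambda_i}{\omega-\lambda_i}\right|\cdot\max_{\mu_i\in\lambda(T)}\sqrt{\frac{(\omega-\mu_i)^2+1}{(\omega+\mu_i)^2+1}},$$ where $\lambda(D)$ and $\lambda(T)$ denote the sets of eigenvalues of $D$ and $T$. In particular, the iteration $x^{(k+1)}=\mathcal{L}_\omega x^{(k)}+\mathcal{F}_\omega^{-1}f$ (equivalently, $(\omega I+\mathcal{B})x^{(k+1/2)}=(\omega I-\mathcal{H})x^{(k)}+f$, $(\omega I+\mathcal{H})x^{(k+1)}=(\omega I-\mathcal{B})x^{(k+1/2)}+f$) converges to the solution of $\mathcal{R}x=f$ for every initial guess and every $f\in\mathbb{R}^{2M}$.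
   Context: Let $T\in\mathbb{R}^{M\times M}$ and $D\in\mathbb{R}^{M\times M}$ be as stated, and let $I$ denote the identity matrix of the appropriate size. Define the $2M\times 2M$ real block matrices $$\mathcal{R}=\begin{bmatrix}T-D & -I\\ I & T-D\end{bmatrix},\quad \mathcal{B}=\begin{bmatrix}-D&0\\0&-D\end{bmatrix},\quad \mathcal{H}=\begin{bmatrix}T&-I\\ I&T\end{bmatrix},$$ so that $\mathcal{R}=\mathcal{B}+\mathcal{H}$. For $\omega>0$ define $$\mathcal{F}_\omega=\tfrac{1}{2\omega}(\omega I+\mathcal{B})(\omega I+\mathcal{H}),\quad \mathcal{G}_\omega=\tfrac{1}{2\omega}(\omega I-\mathcal{B})(\omega I-\mathcal{H}),$$ $$\mathcal{L}_\omega=(\omega I+\mathcal{H})^{-1}(\omega I-\mathcal{B})(\omega I+\mathcal{B})^{-1}(\omega I-\mathcal{H})=\mathcal{F}_\omega^{-1}\mathcal{G}_\omega .$$ *)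

(* Defs.v *)
From HB Require Import structures.
From mathcomp Require Import all_boot all_order all_algebra.
From mathcomp Require Import all_classical all_reals.
From mathcomp Require Import topology normedtype sequences.
From mathcomp.real_closed Require Import complex.
Set Implicit Arguments.
Unset Strict Implicit.
Unset Printing Implicit Defensive.
Import Order.TTheory GRing.Theory Num.Theory.
Local Open Scope ring_scope.
Local Open Scope classical_set_scope.

Section Defs.
Variable R : realType.

Definition cplx_mx n (A : 'M[R]_n) : 'M[R[i]]_n := map_mx (fun x => (x%:C)%C) A.

(* spectral radius: largest modulus of a (complex) eigenvalue
   (sup of a finite set of reals; equals 0 for the empty matrix) *)
Definition spectral_radius n (A : 'M[R]_n) : R :=
  sup [set ComplexField.Normc.normc z | z in [set z : R[i] | eigenvalue (cplx_mx A) z]].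

Definition max_over_eigs n (A : 'M[R]_n) (g : R -> R) : R :=
  sup [set g l | l in [set l : R | eigenvalue A l]].

Definition is_diag n (A : 'M[R]_n) : Prop := forall i j, i != j -> A i j = 0.

Definition sym_posdef n (A : 'M[R]_n) : Prop :=
  A^T = A /\ forall v : 'cV[R]_n, v != 0 -> 0 < (v^T *m A *m v) 0 0.

Definition Rmx M (T D : 'M[R]_M) : 'M[R]_(M + M) :=
  block_mx (T - D) (- 1%:M) 1%:M (T - D).
Definition Bmx M (D : 'M[R]_M) : 'M[R]_(M + M) :=
  block_mx (- D) 0 0 (- D).
Definition Hmx M (T : 'M[R]_M) : 'M[R]_(M + M) :=
  block_mx T (- 1%:M) 1%:M T.

Definition Fmx M (T D : 'M[R]_M) (w : R) : 'M[R]_(M + M) :=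
  (2 * w)^-1 *: ((w%:M + Bmx D) *m (w%:M + Hmx T)).
Definition Lmx M (T D : 'M[R]_M) (w : R) : 'M[R]_(M + M) :=
  invmx (w%:M + Hmx T) *m (w%:M - Bmx D) *m invmx (w%:M + Bmx D) *m (w%:M - Hmx T).

Definition sigma M (T D : 'M[R]_M) (w : R) : R :=
  max_over_eigs D (fun l => `| (w + l) / (w - l) |) *
  max_over_eigs T (fun m => Num.sqrt (((w - m) ^+ 2 + 1) / ((w + m) ^+ 2 + 1))).

Fixpoint iterate M (T D : 'M[R]_M) (w : R) (f x0 : 'cV[R]_(M + M)) (k : nat)
  : 'cV[R]_(M + M) :=
  match k with
  | 0 => x0
  | k'.+1 => Lmx T D w *m iterate T D w f x0 k' + invmx (Fmx T D w) *m f
  end.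

End Defs.

(* Main.v *)
Require Import Defs.
From HB Require Import structures.
From mathcomp Require Import all_boot all_order all_algebra.
From mathcomp Require Import all_classical all_reals.
From mathcomp Require Import topology normedtype sequences.
From mathcomp.real_closed Require Import complex.
From mathcomp Require Import ring lra.
Import Order.TTheory GRing.Theory Num.Theory.
Import numFieldNormedType.Exports.
Local Open Scope ring_scope.
Local Open Scope classical_set_scope.

(* Write [H = S + J] with [S = diag(T, T)] symmetric and [J] a skew isometry
   commuting with [S]: the cross terms vanish, and
   [|(w -+ H) x|^2 = |(w -+ S) x|^2 + |x|^2].  Diagonalising [T] orthogonally,
   [|(w - H) x| <= tau |(w + H) x|], where [tau] is the second factor of [sigma];
   entrywise, [|(w - B) x| <= delta |(w + B) x|], where [delta] is the first.
   Hence [L] contracts the norm [x |-> |(w + H) x|] by [sigma = delta * tau],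
   which bounds the eigenvalues of [L] and gives geometric convergence. *)

(** [eigenvalue] refers to row vectors, whereas the iteration acts on columns; this passes from one
    to the other. *)
Lemma eigenvalue_tr (F : fieldType) n (A : 'M[F]_n) a :
  eigenvalue A^T a = eigenvalue A a.
Proof.
rewrite /eigenvalue /eigenspace !kermx_eq0 !row_free_unit.
by rewrite -[a%:M in LHS]tr_scalar_mx -linearB unitmx_tr.
Qed.

(** [kermx] is a left kernel, so the rows of the kernel of [A^T] are transposed into columns killed
    by [A]. *)
Lemma unitmx_ker0 (F : fieldType) n (A : 'M[F]_n) :
  (forall x : 'cV[F]_n, A *m x = 0 -> x = 0) -> A \in unitmx.
Proof.
move=> kerA; rewrite -unitmx_tr -row_free_unit -kermx_eq0.
apply/eqP/row_matrixP => i; rewrite row0; apply: trmx_inj; rewrite trmx0.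
apply: kerA; apply: trmx_inj; rewrite trmx_mul trmxK trmx0.
by rewrite -row_mul mulmx_ker row0.
Qed.

Section RealMatrices.
Variable R : realType.
Local Open Scope sesquilinear_scope.
Set Implicit Arguments.
Unset Strict Implicit.
Unset Printing Implicit Defensive.
Local Notation toC := (@real_complex_def R (Phant R)).

(** * Squared Euclidean norm *)

Definition nrm2 n (x : 'cV[R]_n) : R := (x^T *m x) 0 0.

Lemma nrm2E n (x : 'cV[R]_n) : nrm2 x = \sum_i x i 0 ^+ 2.
Proof. by rewrite /nrm2 mxE; apply: eq_bigr => i _; rewrite mxE expr2. Qed.

Lemma nrm2_ge0 n (x : 'cV[R]_n) : 0 <= nrm2 x.
Proof. by rewrite nrm2E sumr_ge0 // => i _; rewrite sqr_ge0. Qed.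

Lemma entry_le_nrm2 n (x : 'cV[R]_n) i : x i 0 ^+ 2 <= nrm2 x.
Proof.
by rewrite nrm2E (bigD1 i) //= lerDl sumr_ge0 // => j _; rewrite sqr_ge0.
Qed.

Lemma nrm2_eq0 n (x : 'cV[R]_n) : (nrm2 x == 0) = (x == 0).
Proof.
apply/eqP/eqP => [x0|->]; last by rewrite /nrm2 mulmx0 mxE.
apply/colP => i; rewrite mxE; apply/eqP; rewrite -sqrf_eq0.
by rewrite eq_le sqr_ge0 -x0 entry_le_nrm2.
Qed.

Lemma nrm2_col_mx m n (x : 'cV[R]_m) (y : 'cV[R]_n) :
  nrm2 (col_mx x y) = nrm2 x + nrm2 y.
Proof. by rewrite /nrm2 tr_col_mx mul_row_col mxE. Qed.

(* [S] is symmetric, so the cross terms [c * (S x)^T y] cancel. *)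
Lemma nrm2_block n (S : 'M[R]_n) (c : R) (z : 'cV[R]_(n + n)) : S^T = S ->
  nrm2 (block_mx S (- c%:M) c%:M S *m z) =
  nrm2 (S *m usubmx z) + nrm2 (S *m dsubmx z) + c ^+ 2 * nrm2 z.
Proof.
move=> symS; rewrite -[in LHS](vsubmxK z) -[in X in _ * X](vsubmxK z).
move: (usubmx z) (dsubmx z) => x y.
rewrite mul_block_col !nrm2_col_mx mulNmx !mul_scalar_mx.
have sxy : \sum_i (S *m x) i 0 * y i 0 = \sum_i x i 0 * (S *m y) i 0.
  have -> : \sum_i (S *m x) i 0 * y i 0 = ((S *m x)^T *m y) 0 0.
    by rewrite mxE; apply: eq_bigr => i _; rewrite [RHS]mulrC !mxE mulrC.
  rewrite trmx_mul symS -mulmxA mxE; apply: eq_bigr => i _.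
  by rewrite [x^T _ _]mxE.
move: (S *m x) (S *m y) sxy => Sx Sy sxy; rewrite !nrm2E.
under eq_bigr do rewrite 3!mxE.
under [X in _ + X = _]eq_bigr do rewrite 2!mxE.
have -> : \sum_i (Sx i 0 - c * y i 0) ^+ 2 =
    \sum_i Sx i 0 ^+ 2 - (2 * c) * \sum_i Sx i 0 * y i 0
    + c ^+ 2 * \sum_i y i 0 ^+ 2.
  by rewrite !mulr_sumr -sumrB -big_split; apply: eq_bigr => i _ /=; ring.
have -> : \sum_i (c * x i 0 + Sy i 0) ^+ 2 =
    c ^+ 2 * \sum_i x i 0 ^+ 2 + (2 * c) * \sum_i x i 0 * Sy i 0
    + \sum_i Sy i 0 ^+ 2.
  by rewrite !mulr_sumr -!big_split; apply: eq_bigr => i _ /=; ring.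
by rewrite -sxy; ring.
Qed.

(** * Real eigenvalues and the spectral decomposition of symmetric matrices *)

Lemma eigenvalue_cplx n (A : 'M[R]_n) (l : R) :
  eigenvalue (cplx_mx A) (toC l) = eigenvalue A l.
Proof. exact: eigenvalue_map. Qed.

(** The characteristic polynomial splits over [R[i]]; the real parts of its roots include every real
    eigenvalue. *)
Lemma eigenvalues_finite n (A : 'M[R]_n) :
  exists rs : seq R, forall l, eigenvalue A l -> l \in rs.
Proof.
have [rs ers] := closed_field_poly_normal (char_poly (cplx_mx A)).
exists [seq complex.Re z | z <- rs] => l; rewrite -eigenvalue_cplx.
rewrite eigenvalue_root_char ers (monicP (char_poly_monic _)) scale1r.
by rewrite root_prod_XsubC => /(map_f (@complex.Re R)).
Qed.

(* The weights [r i] are the squared moduli of the coordinates of [y] in a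
   unitary eigenbasis of the complexification of [T]. *)
Lemma sym_spectral_weights n (T : 'M[R]_n) (y : 'cV[R]_n) : T^T = T ->
  exists mu r : 'I_n -> R, [/\ forall i, eigenvalue T (mu i),
    forall i, 0 <= r i &
    forall a b, nrm2 ((a%:M + b *: T) *m y) = \sum_i (a + b * mu i) ^+ 2 * r i].
Proof.
move=> symT; set A := cplx_mx T.
have hA : A \is hermsymmx.
  apply: realsym_hermsym.
    apply/is_hermitianmxP; rewrite expr0 scale1r map_mx_id //.
    by rewrite /A /cplx_mx map_trmx symT.
  by apply/mxOverP => i j; rewrite mxE; apply/complex_realP; exists (T i j).
have /orthomx_spectralP eA := hermitian_normalmx hA.
have /mxOverP rD := hermitian_spectral_diag_real hA.
have uP := spectral_unitarymx A.
move: (spectralmx A) (spectral_diag A) uP rD eA => P d uP rD eA.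
have PA : P *m A = diag_mx d *m P.
  by rewrite eA !mulmxA mulmxV ?unitarymx_unit // mul1mx.
pose z := P *m map_mx toC y.
pose mu i := complex.Re (d 0 i).
have muE i : d 0 i = toC (mu i) by rewrite RRe_real.
(* The unitary [P] preserves the norm and turns [a + b T] into multiplication of the coordinate
   [z i 0] by [a + b * mu i]. *)
have nz a b : toC (nrm2 ((a%:M + b *: T) *m y)) =
   \sum_i toC (a + b * mu i) ^+ 2 * `|z i 0| ^+ 2.
  pose v := map_mx toC ((a%:M + b *: T) *m y).
  have Pv i : (P *m v) i 0 = toC (a + b * mu i) * z i 0.
    rewrite /v map_mxM map_mxD map_scalar_mx map_mxZ mulmxDl mulmxDr.
    rewrite mul_scalar_mx -scalemxAl -!scalemxAr mulmxA PA.
    rewrite -mulmxA -/z mxE [X in X + _]mxE [X in _ + X]mxE mul_diag_mx mxE muE.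
    by rewrite rmorphD rmorphM /=; ring.
  have -> : toC (nrm2 ((a%:M + b *: T) *m y)) = ((P *m v)^t* *m (P *m v)) 0 0.
    rewrite trmx_mul map_mxM -mulmxA (mulmxA (map_mx _ P^T)).
    rewrite -[map_mx _ P^T](invmx_unitary uP) mulVmx ?unitarymx_unit // mul1mx.
    rewrite nrm2E rmorph_sum mxE; apply: eq_bigr => i _.
    rewrite rmorphXn expr2 !mxE /=; congr (_ * _).
    by rewrite conj_Creal //; apply/complex_realP; eexists.
  rewrite mxE; apply: eq_bigr => i _; rewrite mxE mxE Pv.
  rewrite mulrC -normCK normrM exprMn real_normK //.
  by apply/complex_realP; eexists.
exists mu, (fun i => complex.Re (z i 0) ^+ 2 + complex.Im (z i 0) ^+ 2); split.
- move=> i; rewrite -eigenvalue_cplx -muE.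
  (* The rows of [P] are left eigenvectors; a zero row would contradict the diagonal entry 1 of [P]
     times its adjoint. *)
  apply/eigenvalueP; exists (row i P).
    rewrite -row_mul PA; apply/rowP => j; rewrite !mxE (bigD1 i) //= big1.
      by rewrite !mxE eqxx mulr1n addr0.
    by move=> k ki; rewrite !mxE eq_sym (negPf ki) mulr0n mul0r.
  apply/eqP => P0; have := unitarymxP uP; move/matrixP/(_ i i).
  rewrite !mxE eqxx; under eq_bigr => j _.
    have := congr1 (fun u : 'rV_n => u 0 j) P0; rewrite !mxE => ->.
    rewrite mul0r; over.
  by rewrite sumr_const mul0rn => /eqP; rewrite eq_sym oner_eq0.
- by move=> i; rewrite addr_ge0 ?sqr_ge0.
- move=> a b; apply: complexI; rewrite nz rmorph_sum; apply: eq_bigr => i _.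
  by rewrite rmorphM rmorphXn /= add_Re2_Im2.
Qed.

(** * Maxima over the real spectrum *)

Lemma le_max_over_eigs n (A : 'M[R]_n) (g : R -> R) l :
  eigenvalue A l -> g l <= max_over_eigs A g.
Proof.
move=> Al; apply: ub_le_sup; last by exists l.
(* Finiteness bounds the set, so that [sup] is a genuine upper bound. *)
have [rs rsP] := eigenvalues_finite A.
exists (\big[Num.max/0]_(x <- rs) g x) => _ [x /= Ax <-].
exact: le_bigmax_seq (rsP _ Ax) _.
Qed.

Lemma max_over_eigs_le n (A : 'M[R]_n) (g : R -> R) c : 0 <= c ->
  (forall l, eigenvalue A l -> g l <= c) -> max_over_eigs A g <= c.
Proof.
move=> c0 gc; rewrite /max_over_eigs; set E := (X in sup X).
(* With no real eigenvalue the [sup] is 0, hence the hypothesis [0 <= c]. *)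
have [->|/set0P E0] := eqVneq E set0; first by rewrite sup0.
by apply: ge_sup => // _ [l Al <-]; exact: gc.
Qed.

(** Strictness survives the supremum because it is dominated by a maximum over a finite list. *)
Lemma max_over_eigs_lt n (A : 'M[R]_n) (g : R -> R) c : 0 < c ->
  (forall l, eigenvalue A l -> g l < c) -> max_over_eigs A g < c.
Proof.
move=> c0 gc; have [rs rsP] := eigenvalues_finite A.
have lt_c : \big[Num.max/0]_(x <- rs | eigenvalue A x) g x < c.
  exact: bigmax_lt.
apply: le_lt_trans lt_c; apply: max_over_eigs_le.
  exact: bigmax_ge_id.
move=> l Al; exact: le_bigmax_seq (rsP _ Al) Al.
Qed.

Lemma max_over_eigs_ge0 n (A : 'M[R]_n) (g : R -> R) :
  (forall l, 0 <= g l) -> 0 <= max_over_eigs A g.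
Proof.
move=> g0; rewrite /max_over_eigs; set E := (X in sup X).
have [->|/set0P[_ [l /= Al _]]] := eqVneq E set0; first by rewrite sup0.
exact: le_trans (g0 l) (le_max_over_eigs _ Al).
Qed.

(* A real contraction also contracts complex vectors, applied to their real
   and imaginary parts. *)
Lemma spectral_radius_le n (W A : 'M[R]_n) s : W \in unitmx -> 0 <= s ->
  (forall x : 'cV_n, nrm2 (W *m (A *m x)) <= s ^+ 2 * nrm2 (W *m x)) ->
  spectral_radius A <= s.
Proof.
move=> uW s0 WA; rewrite /spectral_radius; set E := (X in sup X).
have [->|/set0P E0] := eqVneq E set0; first by rewrite sup0.
apply: ge_sup => // _ [z /= + <-]; rewrite -eigenvalue_tr.
case/eigenvalueP => u uA u0.
case: z uA => p q uA.
(* [a + i b] is a column eigenvector of [A] for [p + i q]. *)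
pose a := (map_mx (@complex.Re R) u)^T; pose b := (map_mx (@complex.Im R) u)^T.
have Aab i : (A *m a) i 0 = p * a i 0 - q * b i 0 /\
             (A *m b) i 0 = q * a i 0 + p * b i 0.
  have := congr1 (fun v : 'rV_n => v 0 i) uA; rewrite !mxE => uAi.
  have ReS F : complex.Re (\sum_(j < n) F j) = \sum_j complex.Re (F j : R[i]).
    by apply: (big_morph (@complex.Re R)) => // -[? ?] [? ?].
  have ImS F : complex.Im (\sum_(j < n) F j) = \sum_j complex.Im (F j : R[i]).
    by apply: (big_morph (@complex.Im R)) => // -[? ?] [? ?].
  have := congr1 (@complex.Re R) uAi; have := congr1 (@complex.Im R) uAi.
  rewrite ReS ImS; case: (u 0 i) => x y /= im re; split.
    rewrite -re; apply: eq_bigr => j _; rewrite !mxE.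
    by case: (u 0 j) => x' y' /=; ring.
  rewrite addrC -im; apply: eq_bigr => j _; rewrite !mxE.
  by case: (u 0 j) => x' y' /=; ring.
have Aa : A *m a = p *: a - q *: b by apply/colP => i; rewrite (Aab i).1 !mxE.
have Ab : A *m b = q *: a + p *: b by apply/colP => i; rewrite (Aab i).2 !mxE.
(* On the pair [(a, b)], [A] acts as a rotation scaled by the modulus of [p + i q], so the cross
   terms cancel. *)
have pqE : nrm2 (W *m (A *m a)) + nrm2 (W *m (A *m b)) =
    (p ^+ 2 + q ^+ 2) * (nrm2 (W *m a) + nrm2 (W *m b)).
  rewrite Aa Ab mulmxBr mulmxDr -!scalemxAr !nrm2E -!big_split mulr_sumr.
  by apply: eq_bigr => i _; rewrite !mxE /=; ring.
have ab0 : 0 < nrm2 (W *m a) + nrm2 (W *m b).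
  rewrite lt_def addr_ge0 ?nrm2_ge0 // andbT paddr_eq0 ?nrm2_ge0 // !nrm2_eq0.
  apply: contra u0 => /andP[/eqP Wa /eqP Wb].
  have a0 : a = 0 by rewrite -(mulKmx uW a) Wa mulmx0.
  have b0 : b = 0 by rewrite -(mulKmx uW b) Wb mulmx0.
  apply/eqP/rowP => i; have := congr1 (fun v : 'cV_n => v i 0) a0.
  have := congr1 (fun v : 'cV_n => v i 0) b0; rewrite !mxE.
  by case: (u 0 i) => x y /= -> ->.
rewrite /= -[leRHS]ger0_norm // -sqrtr_sqr ler_sqrt ?sqr_ge0 //.
(* Adding the contraction bounds for [a] and [b] and cancelling the positive sum bounds the squared
   modulus by [s ^+ 2]. *)
by rewrite -(ler_pM2r ab0) -pqE mulrDr lerD.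
Qed.


(** One family of weights expresses all three norms, so the bound holds term by term over the
    spectrum. The summand [nrm2 y] is the contribution of the skew part of [Hmx T]. *)
Lemma Cayley_contract n (T : 'M[R]_n) w t (y : 'cV[R]_n) : T^T = T ->
  (forall m, eigenvalue T m ->
     (w - m) ^+ 2 + 1 <= t * ((w + m) ^+ 2 + 1)) ->
  nrm2 ((w%:M - T) *m y) + nrm2 y <= t * (nrm2 ((w%:M + T) *m y) + nrm2 y).
Proof.
move=> symT tT; have [mu [r [muT r0 nrE]]] := sym_spectral_weights y symT.
have /(_ 1 0) := nrE; rewrite scale0r addr0 mul1mx => ->.
have := nrE w 1; rewrite scale1r => ->.
have := nrE w (-1); rewrite scaleN1r => ->.
rewrite -!big_split mulr_sumr; apply: ler_sum => i _ /=.
by have := ler_wpM2r (r0 i) (tT _ (muT i)); lra.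
Qed.

(** * Spectra of diagonal and positive definite matrices *)

Lemma is_diag_mulmx n (A : 'M[R]_n) (x : 'cV[R]_n) i :
  is_diag A -> (A *m x) i 0 = A i i * x i 0.
Proof.
move=> dA; rewrite mxE (bigD1 i) //= big1 ?addr0 // => j ji.
by rewrite dA ?mul0r // eq_sym.
Qed.

Lemma is_diag_eigenvalue n (D : 'M[R]_n) i : is_diag D -> eigenvalue D (D i i).
Proof.
move=> dD; apply/eigenvalueP; exists (delta_mx 0 i).
  apply/rowP => j; rewrite -rowE !mxE eqxx /=.
  by have [->|ji] := eqVneq j i; rewrite ?mulr1 // mulr0 dD // eq_sym.
by apply/eqP => /rowP/(_ i)/eqP; rewrite !mxE !eqxx oner_eq0.
Qed.

Lemma eigenvalue_is_diag n (D : 'M[R]_n) l : is_diag D -> eigenvalue D l ->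
  exists i, l = D i i.
Proof.
move=> dD /eigenvalueP[v vD /rV0Pn[i vi]]; exists i.
have := congr1 (fun u : 'rV_n => u 0 i) vD; rewrite !mxE (bigD1 i) //= big1.
  by rewrite addr0 mulrC => /(mulIf vi).
by move=> j ji; rewrite dD ?mulr0.
Qed.

(** For a row eigenvector [v], the positive number [v T v^T] equals [l] times the squared norm of
    [v]. *)
Lemma eigenvalue_posdef n (T : 'M[R]_n) l :
  sym_posdef T -> eigenvalue T l -> 0 < l.
Proof.
move=> [symT pT] /eigenvalueP[v vT v0].
have := pT v^T; rewrite trmx_eq0 trmxK vT => /(_ v0).
rewrite -scalemxAl [X in 0 < X]mxE -{1}[v]trmxK -/(nrm2 v^T) => lv0.
rewrite ltNge; apply: contraTN lv0 => l0.
by rewrite -leNgt mulr_le0_ge0 ?nrm2_ge0.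
Qed.

(** * The splitting: invertibility, contraction, convergence *)

Section Iteration.
Variables (M : nat) (T D : 'M[R]_M) (w : R).
Hypotheses (pT : sym_posdef T) (dD : is_diag D) (D0 : forall i, D i i <= 0).
Hypothesis w0 : 0 < w.

Let delta := max_over_eigs D (fun l => `| (w + l) / (w - l) |).
Let tau := max_over_eigs T
  (fun m => Num.sqrt (((w - m) ^+ 2 + 1) / ((w + m) ^+ 2 + 1))).

Lemma shiftHmxD : w%:M + Hmx T = block_mx (w%:M + T) (- 1%:M) 1%:M (w%:M + T).
Proof. by rewrite /Hmx scalar_mx_block add_block_mx !add0r. Qed.

(** The off-diagonal blocks are written so as to match [nrm2_block] with [c = -1]. *)
Lemma shiftHmxB :
  w%:M - Hmx T = block_mx (w%:M - T) (- (-1)%:M) (-1)%:M (w%:M - T).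
Proof.
rewrite /Hmx scalar_mx_block opp_block_mx add_block_mx !add0r.
by rewrite (raddfN (@scalar_mx R M)).
Qed.

Lemma sym_shift (a b : R) : (a%:M + b *: T)^T = a%:M + b *: T.
Proof. by rewrite linearD /= tr_scalar_mx linearZ /= pT.1. Qed.

(** The skew part alone contributes the squared norm of [x]. This yields invertibility, and later
    turns decay in the [w + H] norm into entrywise decay. *)
Lemma nrm2_le_shiftHmxD (x : 'cV[R]_(M + M)) :
  nrm2 x <= nrm2 ((w%:M + Hmx T) *m x).
Proof.
rewrite shiftHmxD nrm2_block ?expr1n ?mul1r ?lerDr ?addr_ge0 ?nrm2_ge0 //.
by have := sym_shift w 1; rewrite scale1r.
Qed.

Lemma shiftHmxD_unit : w%:M + Hmx T \in unitmx.
Proof.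
apply: unitmx_ker0 => x Hx; apply/eqP; rewrite -nrm2_eq0 eq_le nrm2_ge0 andbT.
by rewrite (le_trans (nrm2_le_shiftHmxD x)) // Hx /nrm2 mulmx0 mxE.
Qed.

(** [T - D] is symmetric, so [nrm2_block] with [c = 1] shows that [Rmx T D] does not decrease the
    norm. *)
Lemma Rmx_unit : Rmx T D \in unitmx.
Proof.
have symS : (T - D)^T = T - D.
  rewrite linearB /= pT.1; congr (_ - _); apply/matrixP => i j; rewrite mxE.
  by have [->//|ij] := eqVneq i j; rewrite !dD // eq_sym.
apply: unitmx_ker0 => x Rx; apply/eqP; rewrite -nrm2_eq0 eq_le nrm2_ge0 andbT.
have := nrm2_block 1 x symS; rewrite -/(Rmx T D) Rx.
rewrite {1}/nrm2 mulmx0 mxE expr1n mul1r => ->.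
by rewrite lerDr addr_ge0 ?nrm2_ge0.
Qed.

Lemma is_diag_Bmx : is_diag (Bmx D).
Proof.
move=> i j; rewrite /Bmx.
case: (split_ordP i) => i' ->; case: (split_ordP j) => j' -> ij.
- rewrite block_mxEul mxE dD ?oppr0 //; by apply: contra ij => /eqP ->.
- by rewrite block_mxEur mxE.
- by rewrite block_mxEdl mxE.
- rewrite block_mxEdr mxE dD ?oppr0 //; by apply: contra ij => /eqP ->.
Qed.

(** The index [j] is chosen before [s], so that [w + B] and [w - B] involve the same [D j j]. *)
Lemma shiftBmx_entry (x : 'cV[R]_(M + M)) i : exists j,
  forall s, ((w%:M + s *: Bmx D) *m x) i 0 = (w - s * D j j) * x i 0.
Proof.
have [j BD] : exists j, Bmx D i i = - D j j.
  rewrite /Bmx; case: (split_ordP i) => j ->; exists j.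
    by rewrite block_mxEul mxE.
  by rewrite block_mxEdr mxE.
exists j => s; rewrite mulmxDl mul_scalar_mx -scalemxAl.
rewrite [LHS]mxE [X in X + _]mxE [X in _ + X]mxE.
rewrite is_diag_mulmx; last exact: is_diag_Bmx.
by rewrite BD; ring.
Qed.

Lemma shiftBmx_entries (x : 'cV[R]_(M + M)) i : exists j,
  ((w%:M + Bmx D) *m x) i 0 = (w - D j j) * x i 0 /\
  ((w%:M - Bmx D) *m x) i 0 = (w + D j j) * x i 0.
Proof.
have [j E] := shiftBmx_entry x i; exists j.
have := E 1; have := E (-1); rewrite scale1r scaleN1r mulN1r mul1r opprK.
by split.
Qed.

Lemma shift_gt0 j : 0 < w - D j j.
Proof. by rewrite subr_gt0 (le_lt_trans (D0 j)). Qed.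

Lemma shiftBmxD_unit : w%:M + Bmx D \in unitmx.
Proof.
apply: unitmx_ker0 => x Bx; apply/colP => i; rewrite mxE.
have [j [+ _]] := shiftBmx_entries x i; rewrite Bx mxE => /esym/eqP.
by rewrite mulf_eq0 gt_eqF ?shift_gt0 //= => /eqP.
Qed.

(** * The two factors of [sigma] and the contractions they control *)

Lemma delta_ge0 : 0 <= delta.
Proof. by apply: max_over_eigs_ge0 => l; exact: normr_ge0. Qed.

(** Equality occurs when 0 is an eigenvalue of [D], so the strictness of [sigma < 1] has to come
    from [tau]. *)
Lemma delta_le1 : delta <= 1.
Proof.
apply: max_over_eigs_le => // _ /(eigenvalue_is_diag dD)[j ->].
have wD := shift_gt0 j.
rewrite normrM normfV (gtr0_norm wD) ler_pdivrMr // mul1r ler_norml.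
by have := D0 j; move: w0; lra.
Qed.

Lemma tau_ge0 : 0 <= tau.
Proof. by apply: max_over_eigs_ge0 => l; exact: sqrtr_ge0. Qed.

Lemma tau_lt1 : tau < 1.
Proof.
apply: max_over_eigs_lt => // m /(eigenvalue_posdef pT) m0.
have wm : 0 < (w + m) ^+ 2 + 1 by rewrite ltr_wpDl ?sqr_ge0.
rewrite -[ltRHS]sqrtr1 ltr_sqrt // ltr_pdivrMr // mul1r.
(* Denominator minus numerator is [4 * w * m]. *)
by have := mulr_gt0 w0 m0; lra.
Qed.

Lemma sigma_ge0 : 0 <= sigma T D w.
Proof. exact: mulr_ge0 delta_ge0 tau_ge0. Qed.

Lemma sigma_lt1 : sigma T D w < 1.
Proof. exact: le_lt_trans (ler_piMl tau_ge0 delta_le1) tau_lt1. Qed.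

Lemma shiftBmx_contract (z : 'cV[R]_(M + M)) :
  nrm2 ((w%:M - Bmx D) *m z) <= delta ^+ 2 * nrm2 ((w%:M + Bmx D) *m z).
Proof.
rewrite !nrm2E mulr_sumr; apply: ler_sum => i _.
have [j [-> ->]] := shiftBmx_entries z i.
have := le_max_over_eigs (fun l => `| (w + l) / (w - l) |)
  (is_diag_eigenvalue j dD).
rewrite /= -/delta -[_ <= delta]ler_sqr ?nnegrE ?delta_ge0 //.
rewrite real_normK ?num_real // expr_div_n.
rewrite ler_pdivrMr ?exprn_gt0 ?shift_gt0 // => h.
by rewrite !exprMn [leRHS]mulrA ler_wpM2r ?sqr_ge0.
Qed.

Lemma shiftHmx_contract (z : 'cV[R]_(M + M)) :
  nrm2 ((w%:M - Hmx T) *m z) <= tau ^+ 2 * nrm2 ((w%:M + Hmx T) *m z).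
Proof.
have symD : (w%:M + T)^T = w%:M + T.
  by have := sym_shift w 1; rewrite scale1r.
have symB : (w%:M - T)^T = w%:M - T.
  by have := sym_shift w (-1); rewrite scaleN1r.
have tT m : eigenvalue T m ->
    (w - m) ^+ 2 + 1 <= tau ^+ 2 * ((w + m) ^+ 2 + 1).
  move=> /(le_max_over_eigs
    (fun m => Num.sqrt (((w - m) ^+ 2 + 1) / ((w + m) ^+ 2 + 1)))).
  have wm s : 0 < (w + s) ^+ 2 + 1 by rewrite ltr_wpDl ?sqr_ge0.
  rewrite /= -/tau -[_ <= tau]ler_sqr ?nnegrE ?tau_ge0 ?sqrtr_ge0 // sqr_sqrtr.
    by rewrite ler_pdivrMr.
  by rewrite divr_ge0 // ltW.
rewrite shiftHmxD shiftHmxB !nrm2_block // sqrrN expr1n !mul1r.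
have -> : nrm2 z = nrm2 (usubmx z) + nrm2 (dsubmx z).
  by rewrite -nrm2_col_mx vsubmxK.
(* After [nrm2_block] the two halves of [z] decouple, each with its own [nrm2] summand. *)
have := Cayley_contract (usubmx z) pT.1 tT.
by have := Cayley_contract (dsubmx z) pT.1 tT; lra.
Qed.

(* [L] is conjugate by [w + H] to a product of two contractions. *)
Lemma Lmx_contract (x : 'cV[R]_(M + M)) :
  nrm2 ((w%:M + Hmx T) *m (Lmx T D w *m x)) <=
  sigma T D w ^+ 2 * nrm2 ((w%:M + Hmx T) *m x).
Proof.
rewrite /Lmx -!mulmxA mulKVmx ?shiftHmxD_unit // exprMn -mulrA.
apply: le_trans (shiftBmx_contract _) _.
by rewrite mulKVmx ?shiftBmxD_unit // ler_wpM2l ?sqr_ge0 ?shiftHmx_contract.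
Qed.

(** * Fixed point and convergence of the iteration *)

Lemma Fmx_unit : Fmx T D w \in unitmx.
Proof.
rewrite /Fmx unitmxZ ?unitmx_mul ?shiftBmxD_unit ?shiftHmxD_unit //.
by rewrite unitfE invr_eq0 mulf_neq0 ?gt_eqF.
Qed.

(** This is [F L = G] combined with [F - G = B + H = R]; it identifies the fixed point of the
    iteration with the solution of [R x = f]. *)
Lemma Fmx_Lmx : Fmx T D w *m Lmx T D w = Fmx T D w - Rmx T D.
Proof.
(* Commuting these factors puts [w + B] next to its inverse in [F L]. *)
have comm : (w%:M + Bmx D) *m (w%:M - Bmx D) = (w%:M - Bmx D) *m (w%:M + Bmx D).
  rewrite !mulmxDl !mulmxDr !mulNmx !mulmxN !mul_scalar_mx !mul_mx_scalar.
  move: (Bmx D *m Bmx D) (Bmx D) => B2 B.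
  by apply/matrixP => i j; rewrite !mxE; ring.
have -> : Rmx T D = Bmx D + Hmx T.
  by rewrite /Rmx /Bmx /Hmx add_block_mx !add0r addrC.
rewrite /Fmx /Lmx -scalemxAl -mulmxA !(mulmxA (w%:M + Hmx T)).
rewrite mulmxV ?shiftHmxD_unit // mul1mx !mulmxA comm.
rewrite mulmxK ?shiftBmxD_unit //.
rewrite !mulmxDl !mulmxDr !mulNmx !mulmxN !mul_scalar_mx !mul_mx_scalar.
move: (Bmx D *m Hmx T) (Bmx D) (Hmx T) => BH B H.
apply/matrixP => i j; rewrite !mxE.
by field; rewrite gt_eqF.
Qed.

Lemma iterate_cvg (f x0 : 'cV[R]_(M + M)) i j :
  (fun k => iterate T D w f x0 k i j) @ \oo --> (invmx (Rmx T D) *m f) i j.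
Proof.
set xs := invmx (Rmx T D) *m f; rewrite (ord1 j) {j}.
have fix_xs : Lmx T D w *m xs + invmx (Fmx T D w) *m f = xs.
  apply: (can_inj (mulKmx Fmx_unit)).
  rewrite mulmxDr mulmxA Fmx_Lmx mulKVmx ?Fmx_unit // mulmxBl.
  by rewrite /xs mulKVmx ?Rmx_unit // subrK.
pose N (x : 'cV[R]_(M + M)) := nrm2 ((w%:M + Hmx T) *m x).
have errN k : N (iterate T D w f x0 k - xs) <=
    (sigma T D w ^+ k) ^+ 2 * N (x0 - xs).
  elim: k => [|k IHk]; first by rewrite expr0 expr1n mul1r.
  (* Subtracting the fixed-point equation cancels the source term: the error is multiplied by
     [L]. *)
  rewrite /= -[in leLHS]fix_xs opprD addrACA subrr addr0 -mulmxBr.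
  apply: le_trans (Lmx_contract _) _.
  rewrite (exprS _ k) [X in _ <= X * _]exprMn -[leRHS]mulrA.
  by rewrite ler_wpM2l ?sqr_ge0.
(* An entry is bounded by the Euclidean norm, which is bounded by the [w + H] norm. *)
have err k : `|iterate T D w f x0 k i 0 - xs i 0| <=
    Num.sqrt (N (x0 - xs)) * sigma T D w ^+ k.
  rewrite -ler_sqr ?nnegrE ?mulr_ge0 ?exprn_ge0 ?sqrtr_ge0 ?sigma_ge0 //.
  rewrite real_normK ?num_real // exprMn sqr_sqrtr ?nrm2_ge0 // mulrC.
  apply: le_trans (errN k); apply: le_trans (nrm2_le_shiftHmxD _).
  by have := entry_le_nrm2 (iterate T D w f x0 k - xs) i; rewrite !mxE.
apply/subr_cvg0; apply: norm_cvg0.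
apply: squeeze_cvgr (cvg_cst 0) _; last first.
  apply: (@cvg_geometric R (Num.sqrt (N (x0 - xs))) (sigma T D w)).
  by rewrite ger0_norm ?sigma_ge0 ?sigma_lt1.
by near=> k; rewrite normr_ge0 /=; exact: err.
Unshelve. all: by end_near.
Qed.

End Iteration.

End RealMatrices.

Theorem theorem1 (R : realType) (M : nat) (T D : 'M[R]_M) (w : R) :
  sym_posdef T -> is_diag D -> (forall i, D i i <= 0) -> 0 < w ->
  [/\ (w%:M + Bmx D) \in unitmx, (w%:M + Hmx T) \in unitmx,
      spectral_radius (Lmx T D w) <= sigma T D w,
      sigma T D w < 1 &
      Rmx T D \in unitmx /\
      forall (f x0 : 'cV[R]_(M + M)) i j, (fun k => iterate T D w f x0 k i j) @ \oo
                      --> (invmx (Rmx T D) *m f) i j].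
Proof.
move=> pT dD D0 w0; split.
- exact: shiftBmxD_unit.
- exact: shiftHmxD_unit.
- apply: (spectral_radius_le (shiftHmxD_unit w pT)); first exact: sigma_ge0.
  exact: Lmx_contract.
- exact: sigma_lt1.
- by split=> [|f x0 i j]; [exact: Rmx_unit|exact: iterate_cvg].
Qed.
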